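(* Let $X$ be a set, let $F=F_X$ be the free group on the basis $X$, and let $R$ be a commutative unital ring. For every integer $n\ge2$ there is a canonical non-degenerate bilinear map \[ F_{(n,R)}/F_{(n+1,R)}\times H^2(F/F_{(n,R)},R)_{n\text{-Massey}}\to R, \] namely, the map $(gF_{(n+1,R)},\alpha)\mapsto(\mathrm{trg}^{-1}(\alpha))(g)$, for $g\in F_{(n,R)}$, is a well-defined map which is bilinear (over $\mathbb{Z}$) and has trivial left and right kernels.
   Context: $R\langle X\rangle$ is the free associative $R$-algebra on $X$, graded by total degree, $R\langle\langle X\rangle\rangle=\prod_{n=0}^\infty R\langle X\rangle^{(n)}$, and $\mathfrak{d}_R$ is the ideal of $R\langle\langle X\rangle\rangle$ generated by $X$. The Magnus homomorphism $\mu_R\colon F\to R\langle\langle X\rangle\rangle^\times$ is given by $\mu_R(x)=1+x$ for $x\in X$; write $\mu_R(g)=\sum_{w\in X^*}\mu_{R,w}(g)w$, where $X^*$ is the set of finite words in the alphabet $X$ and $|w|$ is the length of $w$. Set $F_{(n,R)}=\mu_R^{-1}(1+\mathfrak{d}_R^n)$, a normal subgroup of $F$. Every coefficient function $\mu_{R,u}$ with $1\le|u|\le n-1$ factors through $F/F_{(n,R)}$. Cohomology is group cohomology with trivial action on $R$, computed by inhomogeneous cochains; $\partial$ is the differential. For $n\ge2$ the transgression map $\mathrm{trg}\colon H^1(F_{(n,R)},R)^F\to H^2(F/F_{(n,R)},R)$ (the differential $d_2^{0,1}$ in the Hochschild–Serre spectral sequence) is an isomorphism, and elements of $H^1(F_{(n,R)},R)$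 are homomorphisms $F_{(n,R)}\to R$. For a word $w=(x_1\cdots x_n)$ of length $n$, define 1-cochains $\bar c_{ij}\in C^1(F/F_{(n,R)},R)$ for $1\le i<j\le n+1$, $(i,j)\ne(1,n+1)$, by $\bar c_{ij}(gF_{(n,R)})=(-1)^{j-i}\mu_{R,(x_i\cdots x_{j-1})}(g)$. They form a defining system for an $n$-fold Massey product, i.e. $\partial\bar c_{ij}=-\sum_{k=i+1}^{j-1}\bar c_{ik}\cup\bar c_{kj}$, and $\sum_{k=2}^n\bar c_{1k}\cup\bar c_{k,n+1}$ is a 2-cocycle; let $\psi_w\in H^2(F/F_{(n,R)},R)$ be its class (the value of the defining system). Then $H^2(F/F_{(n,R)},R)_{n\text{-Massey}}$ is the image of the homomorphism \[ \bigoplus_{w\in X^*,\,|w|=n}R\to H^2(F/F_{(n,R)},R),\qquad (r_w)_w\mapsto\sum_w r_w\psi_w. \] *)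

(* Defs.v *)
From HB Require Import structures.
From mathcomp Require Import all_boot all_algebra finmap.
From mathcomp Require Import zify.
From mathcomp Require Import boolp classical_sets functions cardinality.

Set Implicit Arguments.
Unset Strict Implicit.
Unset Printing Implicit Defensive.

Import GRing.Theory.

Local Open Scope classical_set_scope.
Local Open Scope quotient_scope.
Local Open Scope ring_scope.

Definition free_basis (X : Type) (F : groupType) (iota : X -> F) : Prop :=
  forall (G : groupType) (f : X -> G),
    exists phi : UMagmaMorphism.type F G,
      (forall x, phi (iota x) = f x) /\
      (forall psi : UMagmaMorphism.type F G,
         (forall x, psi (iota x) = f x) -> psi =1 phi).

HB.mixin Record isConjClosed (G : groupType) (S : {pred G}) := {
  gpredJr : forall a g : G, a \in S -> (a ^ g)%g \in S
}.

#[short(type="normalClosed")]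
HB.structure Definition NormalClosed (G : groupType) :=
  {S of GroupClosed G S & isConjClosed G S}.

Section Subgroup.
Context (G : groupType) (H : groupClosed G).

Definition subgroup := {x : G | x \in H}.

HB.instance Definition _ := SubChoice.on subgroup.

Lemma subgroup_closed : group_closed H.
Proof.
split; first exact: gpred1.
by move=> x y xH yH; apply: gpredM => //; apply: gpredVr.
Qed.

HB.instance Definition _ :=
  SubChoice_isSubGroup.Build G _ subgroup subgroup_closed.

End Subgroup.

Section RestrictNormal.
Context (G : groupType) (H : groupClosed G) (N : normalClosed G).

Definition restrict : {pred subgroup H} := fun a => val a \in N.

Lemma restrictE a : (a \in restrict) = (val a \in N). Proof. by []. Qed.

Let restrictM : mulg_closed restrict.
Proof. by move=> a b; rewrite !restrictE; apply: gpredM. Qed.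
Let restrict1 : (1 : subgroup H)%g \in restrict.
Proof. by rewrite restrictE; apply: gpred1. Qed.
Let restrictV : invg_closed restrict.
Proof. by move=> a; rewrite !restrictE; apply: gpredVr. Qed.
Let restrictJ (a g : subgroup H) : a \in restrict -> (a ^ g)%g \in restrict.
Proof. by rewrite !restrictE ; apply: gpredJr. Qed.

HB.instance Definition _ := isMulClosed.Build _ restrict restrictM.
HB.instance Definition _ := isMul1Closed.Build _ restrict restrict1.
HB.instance Definition _ := isInvClosed.Build _ restrict restrictV.
HB.instance Definition _ := isConjClosed.Build _ restrict restrictJ.

End RestrictNormal.

Arguments restrict {G} H N.

Section QuotientGroup.
Context (G : groupType) (N : normalClosed G).
Implicit Types x y : G.

Definition coset_rel x y := (x^-1 * y)%g \in N.

Lemma coset_relP : equiv_class_of coset_rel.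
Proof.
split=> [x|x y|y x z]; rewrite /coset_rel.
- by rewrite mulVg gpred1.
- by apply/idP/idP => /gpredVr; rewrite invgM invgK.
- by move=> xy yz; rewrite -(mulgK y x^-1%g) -mulgA gpredM.
Qed.

Canonical coset_equiv := EquivRelPack coset_relP.
Canonical coset_encModRel := defaultEncModRel coset_rel.

Definition quotient_group := {eq_quot coset_rel}.

HB.instance Definition _ : EqQuotient G coset_rel quotient_group :=
  EqQuotient.on quotient_group.
HB.instance Definition _ := Choice.on quotient_group.

Let Q := quotient_group.

Lemma eq_cosetP x y : reflect (\pi_Q x = \pi_Q y) ((x^-1 * y)%g \in N).
Proof. by apply: (iffP idP) => [xy|/eqmodP//]; apply/eqmodP. Qed.

Definition quo_one : Q := \pi_Q 1%g.
Definition quo_mul (a b : Q) : Q := \pi_Q (repr a * repr b)%g.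
Definition quo_inv (a : Q) : Q := \pi_Q (repr a)^-1%g.

Lemma repr_coset x : (x^-1 * repr (\pi_Q x))%g \in N.
Proof. by apply/eq_cosetP; rewrite reprK. Qed.

Lemma coset_relM x x' y y' : (x^-1 * x')%g \in N -> (y^-1 * y')%g \in N ->
  ((x * y)^-1 * (x' * y'))%g \in N.
Proof.
move=> xN yN; rewrite invgM.
have -> : (y^-1 * x^-1 * (x' * y') = (x^-1 * x') ^ y * (y^-1 * y'))%g.
  by rewrite /conjg !mulgA mulgK.
by rewrite gpredM // gpredJr.
Qed.

Lemma quo_mulE x y : quo_mul (\pi_Q x) (\pi_Q y) = \pi_Q (x * y)%g.
Proof. by apply/esym/eq_cosetP/coset_relM; apply: repr_coset. Qed.

Lemma quo_invE x : quo_inv (\pi_Q x) = \pi_Q x^-1%g.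
Proof.
apply/eq_cosetP; rewrite invgK; set y := repr _.
have -> : (y * x^-1 = ((x^-1 * y) ^ x^-1))%g.
  by rewrite /conjg invgK !mulgA mulgV mul1g.
by apply/gpredJr/repr_coset.
Qed.

Let quo_mulA : associative quo_mul.
Proof.
elim/quotW=> a; elim/quotW=> b; elim/quotW=> c.
rewrite (quo_mulE a b) (quo_mulE b c).
by rewrite (quo_mulE a (b * c)%g) (quo_mulE (a * b)%g c) mulgA.
Qed.
Let quo_mul1 : left_id quo_one quo_mul.
Proof. by elim/quotW=> a; rewrite (quo_mulE 1%g a) mul1g. Qed.
Let quo_1mul : right_id quo_one quo_mul.
Proof. by elim/quotW=> a; rewrite (quo_mulE a 1%g) mulg1. Qed.
Let quo_mulV : left_inverse quo_one quo_inv quo_mul.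
Proof. by elim/quotW=> a; rewrite quo_invE (quo_mulE a^-1%g a) mulVg. Qed.
Let quo_Vmul : right_inverse quo_one quo_inv quo_mul.
Proof. by elim/quotW=> a; rewrite quo_invE (quo_mulE a a^-1%g) mulgV. Qed.

HB.instance Definition _ :=
  isGroup.Build quotient_group quo_mulA quo_mul1 quo_1mul quo_mulV quo_Vmul.

Lemma piM x y : \pi_Q (x * y)%g = (\pi_Q x * \pi_Q y)%g.
Proof. by rewrite -quo_mulE. Qed.

Lemma pi1 : \pi_Q 1%g = 1%g.
Proof. by []. Qed.

End QuotientGroup.

Section UnitGroup.
Context (A : pzRingType).

Definition invertible : {pred A} := fun a => `[< exists b, a * b = 1 /\ b * a = 1 >].

Definition unit_group := {a : A | a \in invertible}.

HB.instance Definition _ := SubChoice.on unit_group.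

Lemma invertible1 : 1 \in invertible.
Proof. by apply/asboolP; exists 1; rewrite mulr1. Qed.

Lemma invertibleM (a b : A) :
  a \in invertible -> b \in invertible -> a * b \in invertible.
Proof.
move=> /asboolP[a' [aa' a'a]] /asboolP[b' [bb' b'b]]; apply/asboolP.
exists (b' * a'); split.
  by rewrite mulrA -(mulrA a) bb' mulr1.
by rewrite mulrA -(mulrA b') a'a mulr1.
Qed.

Definition inverse_of (u : unit_group) : A := xget 0 [set b | val u * b = 1 /\ b * val u = 1].

Lemma inverse_ofP u : val u * inverse_of u = 1 /\ inverse_of u * val u = 1.
Proof. by rewrite /inverse_of; case: xgetP => // E; case: (asboolP _ (svalP u)) => b /E. Qed.

Lemma inverse_of_invertible u : inverse_of u \in invertible.
Proof. by apply/asboolP; exists (val u); case: (inverse_ofP u). Qed.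

Definition unit_one : unit_group := Sub 1 invertible1.
Definition unit_mul (u v : unit_group) : unit_group :=
  Sub (val u * val v) (invertibleM (valP u) (valP v)).
Definition unit_inv (u : unit_group) : unit_group :=
  Sub (inverse_of u) (inverse_of_invertible u).

Let unit_mulA : associative unit_mul.
Proof. by move=> u v w; apply: val_inj => /=; rewrite mulrA. Qed.
Let unit_mul1 : left_id unit_one unit_mul.
Proof. by move=> u; apply: val_inj => /=; rewrite mul1r. Qed.
Let unit_1mul : right_id unit_one unit_mul.
Proof. by move=> u; apply: val_inj => /=; rewrite mulr1. Qed.
Let unit_mulV : left_inverse unit_one unit_inv unit_mul.
Proof. by move=> u; apply: val_inj => /=; case: (inverse_ofP u). Qed.
Let unit_Vmul : right_inverse unit_one unit_inv unit_mul.
Proof. by move=> u; apply: val_inj => /=; case: (inverse_ofP u). Qed.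

HB.instance Definition _ :=
  isGroup.Build unit_group unit_mulA unit_mul1 unit_1mul unit_mulV unit_Vmul.

End UnitGroup.

Section Ideals.
Context (A : pzRingType).

Definition two_sided_ideal (I : set A) : Prop :=
  [/\ I 0, forall a b, I a -> I b -> I (a + b)
    & forall a x b, I x -> I (a * x * b)].

Definition ideal_gen (S : set A) : set A :=
  [set a | forall I, two_sided_ideal I -> S `<=` I -> I a].

Definition ideal_pow (I : set A) (n : nat) : set A :=
  ideal_gen [set \prod_(i < n) a i | a in [set a : 'I_n -> A | forall i, I (a i)]].

Lemma ideal_gen_ideal S : two_sided_ideal (ideal_gen S).
Proof.
split=> [I [] //|a b aI bI I II SI|a x b xI I II SI].
  by have [_ D _] := II; apply: D; [apply: aI|apply: bI].
by have [_ _ M] := II; apply: M; apply: xI.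
Qed.

End Ideals.

Section Series.
Context (X : Type) (R : pzRingType).

(* All functions X^* -> R with the convolution (Cauchy) product; R<<X>> is the
   subring [series] below. *)
Definition words_fun := seq X -> R.

HB.instance Definition _ := GRing.Zmodule.on words_fun.

Definition conv (f g : words_fun) : words_fun := fun w =>
  \sum_(i < (size w).+1) f (take i w) * g (drop i w).

Definition series1 : words_fun := fun w => (nilp w)%:R.

Definition shift x (f : words_fun) : words_fun := fun w => f (x :: w).

Lemma conv_nil f g : conv f g [::] = f [::] * g [::].
Proof. by rewrite /conv big_ord_recl big_ord0 addr0. Qed.

Lemma conv_cons f g x w :
  conv f g (x :: w) = f [::] * g (x :: w) + conv (shift x f) g w.
Proof. by rewrite /conv big_ord_recl. Qed.

Let convDl : left_distributive conv +%R.
Proof.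
move=> f g h; apply/funext => w; rewrite -[RHS]/(conv f h w + conv g h w) /conv.
by rewrite -big_split; apply: eq_bigr => i _; apply: mulrDl.
Qed.
Let convDr : right_distributive conv +%R.
Proof.
move=> f g h; apply/funext => w; rewrite -[RHS]/(conv f g w + conv f h w) /conv.
by rewrite -big_split; apply: eq_bigr => i _; apply: mulrDr.
Qed.
Let conv1 : left_id series1 conv.
Proof.
move=> f; apply/funext => w; rewrite /conv big_ord_recl take0 drop0 mul1r.
rewrite big1 ?addr0 // => i _; rewrite /series1 /= /bump /= add1n.
by case: w i => [[]|x w i] //=; rewrite mul0r.
Qed.
Let conv_1 : right_id series1 conv.
Proof.
move=> f; apply/funext => w; rewrite /conv big_ord_recr /= take_size drop_size mulr1.
rewrite big1 ?add0r // => i _; rewrite /series1 /nilp size_drop.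
by rewrite -[_ == _]/(size w <= i)%N leqNgt ltn_ord mulr0.
Qed.
Let convA : associative conv.
Proof.
move=> f g h; apply/funext => w; elim: w f g h => [|x w IH] f g h.
  by rewrite !conv_nil mulrA.
rewrite !conv_cons conv_nil IH mulrDr -mulrA -addrA; congr (_ + _).
have -> : shift x (conv f g) =
    (fun u => f [::] * shift x g u) + conv (shift x f) g.
  by apply/funext => u; rewrite /shift conv_cons.
rewrite convDl; congr (_ + _); rewrite /conv big_distrr /=.
by apply: eq_bigr => i _; rewrite mulrA.
Qed.

HB.instance Definition _ :=
  GRing.Zmodule_isPzRing.Build words_fun convA conv1 conv_1 convDl convDr.

(* R<<X>> is the product over n of the R<X>^(n), whose elements are finite
   combinations of words of length n: for infinite X this is a genuine
   restriction on the coefficient functions. *)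
Definition is_series : {pred words_fun} := fun f =>
  `[< forall n, finite_set [set w | size w = n /\ f w <> 0] >].

Lemma is_series_subring : subring_closed is_series.
Proof.
split=> [|f g /asboolP Hf /asboolP Hg|f g /asboolP Hf /asboolP Hg]; apply/asboolP => n.
- apply: (sub_finite_set _ (finite_set1 [::])) => w [_] /=.
  by case: w => //= x w; rewrite /(1 : words_fun) /series1.
- apply: (@sub_finite_set _ _ ([set w | size w = n /\ f w <> 0] `|`
     [set w | size w = n /\ g w <> 0])); last by rewrite finite_setU.
  move=> w [sw fgw]; have [f0|fn0] := pselect (f w = 0); [right|by left].
  split=> // g0; apply: fgw; rewrite -[LHS]/(f w - g w) f0 g0.
  exact: subrr.
- pose S (h : words_fun) i := [set w | size w = i /\ h w <> 0].
  apply: (@sub_finite_set _ _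
     (\bigcup_(i in `I_n.+1) (fun p => p.1 ++ p.2) @` (S f i `*` S g (n - i)%N))).
    move=> w [sw fgw]; apply: contrapT => Hn; apply: fgw.
    rewrite -[LHS]/(conv f g w) /conv; apply: big1 => i _.
    have [->|f0] := pselect (f (take i w) = 0); first exact: mul0r.
    have [->|g0] := pselect (g (drop i w) = 0); first exact: mulr0.
    case: Hn; exists (i : nat); first by rewrite /= -sw.
    exists (take i w, drop i w); last by rewrite /= cat_take_drop.
    split; split=> //=; first by rewrite size_takel // -ltnS.
    by rewrite size_drop; congr (_ - _)%N.
  apply: bigcup_finite => [|i _]; first exact: finite_II.
  by apply: finite_image; apply: finite_setX; [apply: Hf|apply: Hg].
Qed.

HB.instance Definition _ := GRing.isSubringClosed.Build _ is_series is_series_subring.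

Definition series := {f : words_fun | f \in is_series}.

HB.instance Definition _ := SubChoice.on series.
HB.instance Definition _ :=
  GRing.SubChoice_isSubPzRing.Build _ _ series is_series_subring.

Definition coef (w : seq X) (f : series) : R := val f w.

Lemma seriesP (f g : series) : (forall w, coef w f = coef w g) -> f = g.
Proof. by move=> fg; apply/val_inj/funext. Qed.

Lemma coefM w f g :
  coef w (f * g) = \sum_(i < (size w).+1) coef (take i w) f * coef (drop i w) g.
Proof. by []. Qed.

Lemma coef1 w : coef w 1 = (nilp w)%:R.
Proof. by []. Qed.

Lemma coefD w f g : coef w (f + g) = coef w f + coef w g.
Proof. by []. Qed.

Lemma coef0 w : coef w 0 = 0.
Proof. by []. Qed.

End Series.

Section Letters.
Context (X : choiceType) (R : pzRingType).
Implicit Types x : X.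

Definition letter_fun x : words_fun X R := fun w => (w == [:: x])%:R.

Lemma letter_is_series x : letter_fun x \in @is_series X R.
Proof.
apply/asboolP => n; apply: (sub_finite_set _ (finite_set1 [:: x])) => w [_].
by rewrite /letter_fun /=; case: eqP.
Qed.

Definition letter x : series X R := Sub (letter_fun x) (letter_is_series x).

(* The inverse of 1 + x is the alternating geometric series in x. *)
Definition geom_fun x : words_fun X R :=
  fun w => if all (pred1 x) w then (-1) ^+ size w else 0.

Lemma geom_is_series x : geom_fun x \in @is_series X R.
Proof.
apply/asboolP => n; apply: (sub_finite_set _ (finite_set1 (nseq n x))) => w [<-].
by rewrite /geom_fun; case: ifP => // /all_pred1P E _; exact: E.
Qed.

Definition geom x : series X R := Sub (geom_fun x) (geom_is_series x).

Lemma geom_cons x y w : geom_fun x (y :: w) = if y == x then - geom_fun x w else 0.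
Proof.
rewrite /geom_fun /=; case: (y == x) => //=; case: ifP; rewrite ?oppr0 //.
by rewrite exprS mulN1r.
Qed.

Lemma letter_geom x w :
  conv (letter_fun x) (geom_fun x) w = if w is [::] then 0 else - geom_fun x w.
Proof.
case: w => [|y w]; first by rewrite conv_nil mul0r.
rewrite conv_cons mul0r add0r geom_cons /conv big_ord_recl take0 drop0 big1.
  rewrite addr0 /shift /letter_fun eqseq_cons andbT.
  by case: (y == x); rewrite ?mul1r ?mul0r ?opprK ?oppr0.
by move=> i _; case: w i => [|z w] [[|i] Hi] //=;
  rewrite /shift /letter_fun eqseq_cons andbF mul0r.
Qed.

Lemma geom_letter x w :
  conv (geom_fun x) (letter_fun x) w = if w is [::] then 0 else - geom_fun x w.
Proof.
elim: w => [|y w IH]; first by rewrite conv_nil mulr0.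
rewrite conv_cons geom_cons mul1r /letter_fun eqseq_cons.
have -> : conv (shift y (geom_fun x)) (letter_fun x) w =
    if y == x then - conv (geom_fun x) (letter_fun x) w else 0.
  rewrite /conv; case: eqP => yx; last first.
    by rewrite big1 // => i _; rewrite /shift geom_cons; case: eqP; rewrite ?mul0r.
  rewrite -sumrN; apply: eq_bigr => i _.
  by rewrite /shift geom_cons yx eqxx mulNr.
rewrite IH; case: (y == x) => /=; last by rewrite addr0 oppr0.
by case: w {IH} => [|z w]; rewrite ?eqxx ?add0r ?oppr0 ?addr0 ?opprK.
Qed.

Lemma one_plus_letter_invertible x : 1 + letter x \in @invertible (series X R).
Proof.
apply/asboolP; exists (geom x).
rewrite mulrDl mulrDr mul1r mulr1; split; apply: seriesP => w;
  rewrite coefD coef1; [rewrite [coef w (_ * _)](letter_geom x w)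
                       |rewrite [coef w (_ * _)](geom_letter x w)];
  by case: w => [|y w]; rewrite ?addr0 // /coef /= subrr.
Qed.

Definition one_plus_letter x : unit_group (series X R) :=
  Sub (1 + letter x) (one_plus_letter_invertible x).

Definition aug_ideal : set (series X R) := ideal_gen (range letter).

Lemma aug_ideal_pow_coef n (f : series X R) w :
  ideal_pow aug_ideal n f -> (size w < n)%N -> coef w f = 0.
Proof.
have van m : two_sided_ideal
    [set f : series X R | forall w, (size w < m)%N -> coef w f = 0].
  split=> [//|g h g0 h0 u um|a g b g0 u um]; first by rewrite coefD g0 ?h0 ?addr0.
  rewrite coefM big1 // => i _; rewrite coefM big1 ?mul0r // => j _.
  rewrite g0 ?mulr0 // size_drop (leq_ltn_trans (leq_subr _ _)) //.
  by rewrite size_take_min (leq_ltn_trans (geq_minr _ _)).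
have aug0 g : aug_ideal g -> coef [::] g = 0.
  move=> /(_ _ (van 1%N)) /(_ _ [::]); apply=> // _ [x _ <-] [|y u] //.
move=> /(_ _ (van n)); apply => _ [a aI <-] u.
elim: n a aI u => // n IH a aI u un.
rewrite big_ord_recl coefM big1 // => i _.
case: (posnP i) => [->|i0]; first by rewrite take0 aug0 ?mul0r //; apply: aI.
rewrite IH ?mulr0 // size_drop ltn_subLR; last by rewrite -ltnS.
by rewrite (leq_trans un) // -add1n leq_add2r.
Qed.

End Letters.

Section Magnus.
Context (X : choiceType) (F : groupType) (iota : X -> F).
Context (Ffree : free_basis iota) (R : pzRingType).
Implicit Types g h : F.

Definition magnus : UMagmaMorphism.type F (unit_group (series X R)) :=
  projT1 (cid (Ffree (@one_plus_letter X R))).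

Lemma magnus_basis x : val (magnus (iota x)) = 1 + letter R x.
Proof. by rewrite /magnus; case: cid => phi [/= -> _]. Qed.

Definition magnus_coef (w : seq X) (g : F) : R := coef w (val (magnus g)).

Lemma magnusM g h : val (magnus (g * h)%g) = val (magnus g) * val (magnus h).
Proof. by rewrite gmulfM. Qed.

Lemma magnus1 : val (magnus 1%g) = 1.
Proof. by rewrite gmulf1. Qed.

Definition magnus_filtration (n : nat) : {pred F} := fun g =>
  `[< ideal_pow (@aug_ideal X R) n (val (magnus g) - 1) >].

Section Normal.
Variable n : nat.
Let I := ideal_pow (@aug_ideal X R) n.
Let I0 : I 0. Proof. by case: (ideal_gen_ideal _ : two_sided_ideal I). Qed.
Let ID a b : I a -> I b -> I (a + b).
Proof. by case: (ideal_gen_ideal _ : two_sided_ideal I) => _ + _; apply. Qed.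
Let IM a x b : I x -> I (a * x * b).
Proof. by case: (ideal_gen_ideal _ : two_sided_ideal I) => _ _; apply. Qed.

Let filtrationM : mulg_closed (magnus_filtration n).
Proof.
move=> g h /asboolP gI /asboolP hI; apply/asboolP; rewrite magnusM.
set a := val _ in gI *; set b := val _ in hI *.
have -> : a * b - 1 = 1 * (a - 1) * b + (b - 1).
  by rewrite mul1r mulrBl mul1r addrA subrK.
by apply: ID => //; apply: IM.
Qed.
Let filtration1 : 1%g \in magnus_filtration n.
Proof. by apply/asboolP; rewrite magnus1 subrr. Qed.
Let filtrationV : invg_closed (magnus_filtration n).
Proof.
move=> g /asboolP gI; apply/asboolP.
have gV : val (magnus g^-1%g) * val (magnus g) = 1.
  by rewrite -magnusM mulVg magnus1.
have -> : val (magnus g^-1%g) - 1 =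
    - val (magnus g^-1%g) * (val (magnus g) - 1) * 1.
  by rewrite mulr1 mulNr mulrBr mulr1 gV opprB.
exact: IM.
Qed.
Let filtrationJ g h :
  g \in magnus_filtration n -> (g ^ h)%g \in magnus_filtration n.
Proof.
move=> /asboolP gI; apply/asboolP; rewrite /conjg !magnusM.
have hV : val (magnus h^-1%g) * val (magnus h) = 1.
  by rewrite -magnusM mulVg magnus1.
set a := val (magnus h^-1%g) in hV *; set b := val (magnus h) in hV *.
have -> : a * (val (magnus g) * b) - 1 = a * (val (magnus g) - 1) * b.
  by rewrite mulrBr mulr1 mulrBl hV mulrA.
exact: IM.
Qed.

HB.instance Definition _ := isMulClosed.Build _ (magnus_filtration n) filtrationM.
HB.instance Definition _ := isMul1Closed.Build _ (magnus_filtration n) filtration1.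
HB.instance Definition _ := isInvClosed.Build _ (magnus_filtration n) filtrationV.
HB.instance Definition _ := isConjClosed.Build _ (magnus_filtration n) filtrationJ.

End Normal.

Lemma magnus_coefM w g h : magnus_coef w (g * h)%g =
  \sum_(i < (size w).+1) magnus_coef (take i w) g * magnus_coef (drop i w) h.
Proof. by rewrite /magnus_coef magnusM coefM. Qed.

Lemma magnus_coef_nil g : magnus_coef [::] g = 1.
Proof.
pose A := series X R.
have coefM0 (a b : A) : coef [::] (a * b) = coef [::] a * coef [::] b.
  by rewrite coefM big_ord1.
have unit0 (u : unit_group A) : coef [::] (val u) \in @invertible R.
  have [uv vu] := inverse_ofP u; apply/asboolP; exists (coef [::] (inverse_of u)).
  by rewrite -!coefM0 uv vu coef1.
pose f h : unit_group R := exist _ (coef [::] (val (magnus h))) (unit0 (magnus h)).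
have fM : monoid.monoid_morphism f.
  split=> [|h k]; apply: val_inj; first by rewrite /= gmulf1.
  by rewrite /= magnusM coefM0.
pose phi : UMagmaMorphism.type F (unit_group R) :=
  HB.pack f (isUMagmaMorphism.Build _ _ f fM).
have [psi [_ uniq]] := Ffree (fun=> 1%g : unit_group R).
have := uniq phi; have := uniq (@one_fun F (unit_group R)).
move=> /(_ (fun=> erefl) g) one_psi /(_ _ g) phi_psi.
suff /(congr1 val) : f g = 1%g by [].
rewrite [LHS]phi_psi -?one_psi // => x; apply: val_inj.
by rewrite /= magnus_basis coefD coef1 /coef /= addr0.
Qed.

Lemma magnus_coef_quotient n w g h : (size w < n)%N ->
  \pi_(quotient_group (magnus_filtration n)) g =
    \pi_(quotient_group (magnus_filtration n)) h ->
  magnus_coef w g = magnus_coef w h.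
Proof.
move=> wn /eq_cosetP/asboolP ghI.
have hE : val (magnus h) =
    val (magnus g) + val (magnus g) * (val (magnus (g^-1 * h)%g) - 1) * 1.
  by rewrite mulr1 mulrBr -magnusM mulVKg mulr1 addrC subrK.
have [_ _ M] : two_sided_ideal (ideal_pow (@aug_ideal X R) n).
  exact: ideal_gen_ideal.
rewrite /magnus_coef hE coefD [X in _ + X](aug_ideal_pow_coef _ wn) ?addr0 //.
exact: M ghI.
Qed.

End Magnus.

Section Cohomology.
Context (G : groupType) (R : comPzRingType).

Definition cochain1 := G -> R.
(* R^o : R as a module over itself, so that cochains form an R-module. *)
Definition cochain2 := G * G -> R^o.

HB.instance Definition _ := GRing.Lmodule.on cochain2.

Definition d1 (c : cochain1) : cochain2 := fun p =>
  c p.2 - c (p.1 * p.2)%g + c p.1.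

Definition d2 (z : cochain2) (g h k : G) : R :=
  z (h, k) - z ((g * h)%g, k) + z (g, (h * k)%g) - z (g, h).

Definition cup (a b : cochain1) : cochain2 := fun p => a p.1 * b p.2.

Definition is_cocycle2 : {pred cochain2} := fun z =>
  `[< forall g h k, d2 z g h k = 0 >].

Lemma d2_linear a (y z : cochain2) g h k :
  d2 (a *: y + z) g h k = a * d2 y g h k + d2 z g h k.
Proof.
have E p : (a *: y + z) p = a * y p + z p by [].
rewrite /d2 !E !mulrBr mulrDr mulrBr !opprD.
by rewrite [LHS](AC (2*2*2*2) ((1*3*5*7)*(2*4*6*8))).
Qed.

Lemma is_cocycle2_submod : submod_closed is_cocycle2.
Proof.
split=> [|a y z /asboolP dy /asboolP dz]; apply/asboolP => g h k.
  by rewrite /d2 !subr0 addr0.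
by rewrite d2_linear dy dz mulr0 addr0.
Qed.

HB.instance Definition _ :=
  GRing.isSubmodClosed.Build _ _ is_cocycle2 is_cocycle2_submod.

Definition cocycle2 := {z : cochain2 | z \in is_cocycle2}.

HB.instance Definition _ := SubChoice.on cocycle2.
HB.instance Definition _ :=
  GRing.SubChoice_isSubLmodule.Build _ _ _ cocycle2 (GRing.subsemimodClosedP is_cocycle2).

Definition is_coboundary2 : {pred cocycle2} := fun z =>
  `[< exists c : cochain1, val z = d1 c >].

Lemma is_coboundary2_submod : submod_closed is_coboundary2.
Proof.
split=> [|a y z /asboolP[c yc] /asboolP[e ze]]; apply/asboolP.
  by exists (fun=> 0); apply/funext => p; rewrite /d1 subrr addr0.
exists (fun g => a * c g + e g); apply/funext => p.
have -> : val (a *: y + z) p = a * val y p + val z p by [].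
rewrite yc ze.
rewrite /d1 mulrDr mulrBr opprD.
by rewrite [LHS](AC (3*3) (((1*4)*(2*5))*(3*6))).
Qed.

HB.instance Definition _ :=
  GRing.isSubmodClosed.Build _ _ is_coboundary2 is_coboundary2_submod.

Definition H2 := Quotient.quot is_coboundary2.

HB.instance Definition _ := GRing.Zmodule.on H2.
HB.instance Definition _ := Quotient.on H2.

Definition class2 (z : cocycle2) : H2 := \pi z.

Lemma class2P y z : class2 y = class2 z <-> exists c, val y - val z = d1 c.
Proof.
split=> [/eqP|[c yz]].
  by rewrite -Quotient.idealrBE => /asboolP[c yz]; exists c.
by apply/eqP; rewrite -Quotient.idealrBE; apply/asboolP; exists c.
Qed.

Definition scale2 (a : R) (q : H2) : H2 := class2 (a *: repr q).

Lemma scale2E a z : scale2 a (class2 z) = class2 (a *: z).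
Proof.
apply/eqP; rewrite -Quotient.idealrBE -scalerBr rpredZ // Quotient.idealrBE.
by rewrite reprK.
Qed.

Lemma class2W (P : H2 -> Prop) : (forall z, P (class2 z)) -> forall q, P q.
Proof. by move=> Pz q; rewrite -[q]reprK; apply: Pz. Qed.

Lemma class2D y z : class2 (y + z) = class2 y + class2 z.
Proof. by rewrite /class2 !piE. Qed.

Let scale2A a b q : scale2 a (scale2 b q) = scale2 (a * b) q.
Proof.
elim/class2W: q => z.
by rewrite (scale2E b z) (scale2E a (b *: z)) (scale2E (a * b) z) scalerA.
Qed.
Let scale21 : left_id 1 scale2.
Proof. by elim/class2W=> z; rewrite (scale2E 1 z) scale1r. Qed.
Let scale2Dr : right_distributive scale2 +%R.
Proof.
move=> a; elim/class2W=> y; elim/class2W=> z.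
by rewrite -class2D (scale2E a y) (scale2E a z) (scale2E a (y + z)) scalerDr class2D.
Qed.
Let scale2Dl q : {morph scale2^~ q : a b / a + b}.
Proof.
elim/class2W: q => z a b.
by rewrite (scale2E a z) (scale2E b z) (scale2E (a + b) z) scalerDl class2D.
Qed.

HB.instance Definition _ :=
  GRing.Zmodule_isLmodule.Build R H2 scale2A scale21 scale2Dr scale2Dl.

Lemma class2_is_linear : linear class2.
Proof. by move=> a y z; rewrite class2D -scale2E. Qed.

(* The value of a defining system: m is the largest index, the cochains are
   c i j with 1 <= i < j <= m. *)
Definition defining_system (m : nat) (c : nat -> nat -> cochain1) : Prop :=
  forall i j, (1 <= i)%N -> (i < j)%N -> (j <= m)%N -> (i, j) <> (1%N, m) ->
    d1 (c i j) = - \sum_(i.+1 <= k < j) cup (c i k) (c k j).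

Definition massey_cochain (m : nat) (c : nat -> nat -> cochain1) : cochain2 :=
  \sum_(2 <= k < m) cup (c 1%N k) (c k m).

Lemma massey_cocycle m c : defining_system m c -> massey_cochain m c \in is_cocycle2.
Proof.
move=> Dc; apply/asboolP => g h k.
have sumE (a b : nat) (f : nat -> cochain2) p :
    (\sum_(a <= i < b) f i) p = \sum_(a <= i < b) f i p.
  exact: (congr1 (fun u => u p) (fct_sumE _ _ _)).
have cM i j x y : (1 <= i)%N -> (i < j)%N -> (j <= m)%N -> (i, j) <> (1%N, m) ->
    c i j (x * y)%g = c i j x + c i j y + \sum_(i.+1 <= l < j) c i l x * c l j y.
  move=> i1 ij jm ne; have /(congr1 (fun z => z (x, y))) := Dc i j i1 ij jm ne.
  rewrite [in RHS]/(- _) /= sumE /d1 /= => E.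
  rewrite -[X in _ + X]opprK -E [X in _ - X]addrAC opprB.
  by rewrite (addrC (c i j y)) [RHS]addrC subrK.
rewrite /d2 /massey_cochain !sumE /cup /=.
under [X in _ - X + _]eq_big_nat => l /andP[l1 lm].
  rewrite cM ?(ltnW lm) //; last by case=> E; rewrite E ltnn in lm.
  rewrite mulrDl mulrDl big_distrl /=; over.
under [X in _ + X - _]eq_big_nat => l /andP[l1 lm].
  rewrite cM ?(ltnW l1) //; last by case=> E; rewrite E in l1.
  rewrite mulrDr mulrDr big_distrr /=; over.
rewrite !big_split /=.
have -> : \sum_(2 <= i < m) \sum_(2 <= j < i) c 1%N j g * c j i h * c i m k =
    \sum_(2 <= i < m) \sum_(i.+1 <= j < m) c 1%N i g * (c i j h * c j m k).
  under eq_bigr => i _ do under eq_bigr => j _ do rewrite -mulrA.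
  transitivity (\sum_(2 <= i < m) \sum_(2 <= j < m | (j < i)%N)
      c 1%N j g * (c j i h * c i m k)).
    apply: eq_big_nat => i /andP[_ im].
    by rewrite (big_nat_widen _ _ _ _ _ (ltnW im)).
  rewrite (exchange_big_dep xpredT) //=; apply: eq_big_nat => i /andP[i2 _].
  by rewrite [RHS](big_nat_widenl _ 2) ?(leq_trans i2).
have cancel_sums (A B C T : R) : B - (A + B + T) + (C + A + T) - C = 0.
  rewrite -addrA -(addrA C A T) [C + _]addrC addrK [A + B + T]addrAC opprD.
  by rewrite [B + _]addrC subrK addNr.
exact: cancel_sums.
Qed.

Definition massey_cocycle2 m c (Dc : defining_system m c) : cocycle2 :=
  Sub (massey_cochain m c) (massey_cocycle Dc).

Definition massey_value m c (Dc : defining_system m c) : H2 :=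
  class2 (massey_cocycle2 Dc).

End Cohomology.

Section Transgression.
Context (G : groupType) (N : normalClosed G) (R : comPzRingType).

(* H^1(N,R)^G: the homomorphisms N -> R invariant under conjugation by G. *)
Record invariant_hom := InvariantHom {
  invariant_hom_fun :> subgroup N -> R;
  invariant_homM : forall a b,
    invariant_hom_fun (a * b)%g = invariant_hom_fun a + invariant_hom_fun b;
  invariant_homJ : forall (g : G) a b,
    val b = (val a ^ g)%g -> invariant_hom_fun b = invariant_hom_fun a
}.

(* The usual cochain description of trg: extend phi to a 1-cochain c on G whose
   coboundary is inflated from a 2-cocycle z on G/N; then trg phi is the class
   of z. *)
Definition is_transgression (phi : invariant_hom) (q : H2 (quotient_group N) R) : Prop :=
  exists (c : cochain1 G R) (z : cocycle2 (quotient_group N) R),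
    [/\ forall a : subgroup N, c (val a) = phi a,
        forall g h, d1 c (g, h) = val z (\pi g, \pi h)
      & q = class2 z].

Lemma d2_d1 (c : cochain1 G R) g h k : d2 (d1 c) g h k = 0.
Proof.
rewrite /d2 /d1 /= mulgA.
set a := c h; set b := c k; set e := c (h * k)%g; set f := c (g * h * k)%g.
set i := c (g * h)%g; set j := c g.
rewrite !opprD !opprK.
have -> : b - e + a + (- b + f - i) + (e - f + j) + (- a + i - j) =
    (b - b) + (e - e) + (a - a) + (f - f) + (i - i) + (j - j).
  by rewrite [LHS](AC (3*3*3*3) ((1*4)*(7*2)*(3*10)*(5*8)*(11*6)*(9*12))).
by rewrite !subrr !addr0.
Qed.

Lemma transgression_exists phi : exists q, is_transgression phi q.
Proof.
pose Q := quotient_group N.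
pose sub x (xN : x \in N) : subgroup N := exist _ x xN.
pose s (p : Q) : G := repr p.
have sN g : ((s (\pi_Q g))^-1 * g)%g \in N by apply/eq_cosetP; rewrite reprK.
have sM (p q : Q) : ((s (p * q)%g)^-1 * (s p * s q))%g \in N.
  by apply/eq_cosetP; rewrite reprK piM !reprK.
have s1 : s 1%g \in N by have := gpredVr _ (sN 1%g); rewrite mulg1 invgK.
pose c : cochain1 G R := fun g => phi (sub _ (sN g)) + phi (sub _ s1).
pose z : cochain2 Q R := fun p => phi (sub _ s1) - phi (sub _ (sM p.1 p.2)).
have cz g h : d1 c (g, h) = z (\pi g, \pi h).
  rewrite /d1 /c /z /=.
  pose a := s (\pi g); pose t := s (\pi h).
  have aJ : ((a^-1 * g) ^ t)%g \in N by apply: gpredJr; apply: sN.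
  have -> : sub _ (sN (g * h)%g) =
      (sub _ (sM (\pi_Q g) (\pi_Q h)) * sub _ aJ * sub _ (sN h))%g :> subgroup N.
    apply: val_inj; rewrite !gmulfM /= /conjg piM -/a -/t !mulgA.
    by rewrite !(mulgK, mulgVK).
  rewrite !invariant_homM (@invariant_homJ _ t (sub _ (sN g)) (sub _ aJ)) //.
  set u := phi (sub _ (sM _ _)); set v := phi (sub _ (sN g)).
  set w := phi (sub _ (sN h)); set o := phi _.
  rewrite [w + o]addrC !opprD.
  have -> : o + w + (- u - v - w - o) + (v + o) = (w - w) + (v - v) + (o - o) + (o - u).
    by rewrite [LHS](AC (2*4*2) ((2*5)*(7*4)*(1*6)*(8*3))).
  by rewrite !subrr !add0r.
have zc : z \in @is_cocycle2 Q R.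
  apply/asboolP => p q r; rewrite -[p]reprK -[q]reprK -[r]reprK.
  by rewrite /d2 -!piM -!cz; apply: d2_d1.
exists (class2 (Sub z zc)), c, (Sub z zc); split=> // a.
have a1 : \pi_Q (val a) = 1%g.
  by rewrite -pi1; apply/esym/eq_cosetP; rewrite invg1 mul1g; apply: valP.
rewrite /c -invariant_homM; apply: (@invariant_homJ _ (s 1%g)).
by rewrite gmulfM /= a1 /conjg mulgA.
Qed.

Definition trg (phi : invariant_hom) : H2 (quotient_group N) R :=
  projT1 (cid (transgression_exists phi)).

Lemma trgP phi : is_transgression phi (trg phi).
Proof. exact: projT2 (cid _). Qed.

Lemma trg_unique phi q : is_transgression phi q -> trg phi = q.
Proof.
case=> [c' [z' [c'a c'z ->]]]; have [c [z [ca cz ->]]] := trgP phi.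
pose e g := c g - c' g.
have eN g : g \in N -> e g = 0.
  by move=> gN; rewrite /e (ca (exist _ g gN)) (c'a (exist _ g gN)) subrr.
have ed g h : val z (\pi g, \pi h) - val z' (\pi g, \pi h) = e h - e (g * h)%g + e g.
  by rewrite -cz -c'z /d1 /= /e !opprD !opprK [LHS](AC (3*3) ((1*4)*(2*5)*(3*6))).
have ecoset g a : a \in N -> e (g * a)%g = e g.
  move=> aN; have := ed g a; have <- : \pi_(quotient_group N) 1%g = \pi a.
    by apply/eq_cosetP; rewrite invg1 mul1g.
  rewrite ed mulg1 (eN 1%g) ?gpred1 // (eN a) // !sub0r addNr => /esym/eqP.
  by rewrite addrC subr_eq0 => /eqP.
apply/class2P; exists (fun p => e (repr p)); apply/funext => -[p r].
have er g : e (repr (\pi_(quotient_group N) g)) = e g.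
  by rewrite -[RHS](ecoset _ _ (repr_coset N g)) mulVKg.
elim/quotW: p => g; elim/quotW: r => h.
by rewrite /d1 /= -piM !er; apply: ed.
Qed.

End Transgression.

Section MagnusMassey.
Context (X : choiceType) (F : groupType) (iota : X -> F).
Context (Ffree : free_basis iota) (R : comPzRingType) (n : nat).

Local Notation FN := (quotient_group (magnus_filtration Ffree R n)).

(* The subword x_i ... x_{j-1} of w = x_1 ... x_n. *)
Definition subword (w : seq X) (i j : nat) : seq X := take (j - i) (drop i.-1 w).

Definition cbar (w : n.-tuple X) (i j : nat) : cochain1 FN R := fun q =>
  (-1) ^+ (j - i) * magnus_coef Ffree R (subword w i j) (repr q).

Lemma cbarE (w : n.-tuple X) i j g :
  (1 <= i)%N -> (i < j)%N -> (j <= n.+1)%N -> (i, j) <> (1%N, n.+1) ->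
  cbar w i j (\pi g) = (-1) ^+ (j - i) * magnus_coef Ffree R (subword w i j) g.
Proof.
move=> i1 ij jn ne; rewrite /cbar (magnus_coef_quotient _ (reprK (\pi_FN g))) //.
rewrite size_take_min (leq_ltn_trans (geq_minl _ _)) // ltn_neqAle leq_subLR.
rewrite (leq_trans jn) ?andbT -?(add1n n) ?leq_add2r //; apply/eqP => jin; apply: ne.
by case: i i1 ij jin => [|[|i]] // _ ij jin; congr (_, _); lia.
Qed.

Lemma cbar_defining_system (w : n.-tuple X) : defining_system n.+1 (cbar w).
Proof.
move=> i j i1 ij jn ne; apply/funext => -[p q].
elim/quotW: p => g; elim/quotW: q => h.
rewrite [in RHS]/(- _) /= fct_sumE /d1 /= -piM !cbarE // magnus_coefM.
have sz : size (subword w i j) = (j - i)%N.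
  by rewrite size_takel // size_drop size_tuple; lia.
rewrite sz.
have -> : \sum_(i.+1 <= k < j) cup (cbar w i k) (cbar w k j) (\pi g, \pi h) =
    \sum_(1 <= a < j - i) (-1) ^+ (j - i) *
      (magnus_coef Ffree R (take a (subword w i j)) g *
       magnus_coef Ffree R (drop a (subword w i j)) h).
  rewrite -[i.+1]addn1 addnC big_addn; apply: eq_big_nat => a /andP[a1 aji].
  rewrite /cup /= cbarE ?cbarE; try (by case; lia) || lia.
  have -> : subword w i (a + i) = take a (subword w i j).
    by rewrite /subword take_takel ?addnK; [|lia].
  have -> : subword w (a + i) j = drop a (subword w i j).
    have -> : subword w i j = take (j - (a + i) + a) (drop i.-1 w).
      by congr (take _ _); lia.
    by rewrite -take_drop drop_drop; congr (take _ (drop _ _)); lia.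
  by rewrite mulrACA -exprD; congr (_ ^+ _ * _); lia.
case E : (j - i)%N => [|d]; first by lia.
rewrite -(big_mkord xpredT (fun a => magnus_coef Ffree R (take a _) g *
   magnus_coef Ffree R (drop a _) h)).
rewrite big_nat_recr //= big_nat_recl //= -big_distrr /=.
rewrite big_add1 /= take0 drop0 take_oversize ?drop_oversize ?sz ?E //.
rewrite !magnus_coef_nil mul1r mulr1 -mulrBr -mulrDr -mulrN; congr (_ * _).
by rewrite opprD addrA subrK opprD addrA subrr sub0r.
Qed.

Definition psi (w : n.-tuple X) : H2 FN R := massey_value (cbar_defining_system w).

Definition massey_map (r : {fsfun n.-tuple X -> R with 0}) : H2 FN R :=
  \sum_(w <- finsupp r) r w *: psi w.

Definition H2_Massey : set (H2 FN R) := range massey_map.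

End MagnusMassey.

Arguments psi {X F iota} Ffree R {n} w.
Arguments massey_map {X F iota} Ffree R n r.
Arguments H2_Massey {X F iota} Ffree R n _.

(* Main.v *)
From HB Require Import structures.
Require Import Defs.
From mathcomp Require Import all_boot all_algebra finmap.
From mathcomp Require Import zify ring.
From mathcomp Require Import boolp classical_sets cardinality.
From mathcomp Require functions.

Set Implicit Arguments.
Unset Strict Implicit.
Unset Printing Implicit Defensive.

Import GRing.Theory.

Local Open Scope fset_scope.
Local Open Scope quotient_scope.
Local Open Scope ring_scope.

(** Write N for the subgroup F_(n,R) of the free group F and mu_w for the
    Magnus coefficient at the word w.

    The transgression of N is bijective.  A 2-cocycle of F/N inflates to a
    coboundary d c on F, because a free group has no second cohomology
    ([free_cocycle_coboundary]: the central extension defined by a cocycle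
    splits over a basis); once normalised to vanish at 1, the cochain c
    restricts to an F-invariant homomorphism on N whose transgression is the
    given class ([trg_of_cochain], [trg_free_surj]).  Two invariant
    homomorphisms with the same transgression differ on N by a homomorphism
    F -> R.  On a given g such a homomorphism is an R-combination of the
    coefficients mu_x(g) for letters x ([free_hom_magnus]), so it vanishes on
    N as soon as n >= 2 ([trg_free_inj]).

    For a word w of length n the identity for mu_w(gh) says exactly that the
    Massey cochain of w inflates to the coboundary of (-1)^(n+1) mu_w
    ([massey_primitive]).  Hence the inverse transgression of the sum of the
    r_w psi_w is, on N, the function (-1)^(n+1) times the sum of the r_w mu_w
    ([trg_massey]): the pairing evaluates Magnus coefficients of length n.

    These coefficients vanish on F_(n+1,R), so the pairing is well defined on
    the quotient.  The right kernel is zero because a class is determined by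
    the homomorphism on N it comes from.  For the left kernel, pairing with
    the psi_w shows that every coefficient of length n of g vanishes, and
    [magnus_filtrationP] then puts g in F_(n+1,R).  That last step needs the
    Magnus expansion of g to involve finitely many letters only: over an
    infinite alphabet a series without terms of degree < m need not lie in
    the m-th power of the ideal generated by the letters. *)

(** * Induction over a free group *)

Section FreeGroup.
Context (X : choiceType) (F : groupType) (iota : X -> F).
Context (Ffree : free_basis iota).

Lemma free_endo_id (f : UMagmaMorphism.type F F) :
  (forall x, f (iota x) = iota x) -> f =1 id.
Proof.
move=> fi g; have [phi [_ uniq]] := Ffree iota.
by rewrite (uniq f fi) -(uniq idfun).
Qed.

Section Induction.
Context (P : F -> Prop) (P1 : P 1%g).
Context (PM : forall g h, P g -> P h -> P (g * h)%g).
Context (PV : forall g, P g -> P g^-1%g) (Pi : forall x, P (iota x)).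

Definition holds : {pred F} := fun g => `[< P g >].
Let S1 : 1%g \in holds. Proof. exact/asboolP. Qed.
Let SM : mulg_closed holds.
Proof. by move=> g h /asboolP Pg /asboolP Ph; apply/asboolP/PM. Qed.
Let SV : invg_closed holds.
Proof. by move=> g /asboolP Pg; apply/asboolP/PV. Qed.
HB.instance Definition _ := isMulClosed.Build _ holds SM.
HB.instance Definition _ := isMul1Closed.Build _ holds S1.
HB.instance Definition _ := isInvClosed.Build _ holds SV.

(** The elements satisfying [P] form a subgroup, and the universal property
    yields a retraction of [F] onto it: composed with the inclusion, it is an
    endomorphism fixing the basis, hence the identity. *)
Lemma free_ind g : P g.
Proof.
pose H := subgroup (holds : groupClosed F).
have Si x : iota x \in holds by exact/asboolP.
have [phi [phi_iota _]] := Ffree (fun x => exist _ (iota x) (Si x) : H).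
pose f g := val (phi g) : F.
have fM : monoid.monoid_morphism f.
  by split=> [|h k]; rewrite /f ?gmulf1 ?gmulfM.
pose f' : UMagmaMorphism.type F F := HB.pack f (isUMagmaMorphism.Build _ _ f fM).
rewrite -[g](@free_endo_id f'); first by move: (valP (phi g)) => /asboolP.
by move=> x; rewrite /= /f phi_iota.
Qed.

End Induction.

(** An element is a word in finitely many basis elements.  The induction
    proves [P S' g] for all [S'] containing some [S], so that the sets found for
    two factors can be merged into their union. *)
Lemma free_ind_finite (P : {fset X} -> F -> Prop) :
    (forall S, P S 1%g) ->
    (forall S g h, P S g -> P S h -> P S (g * h)%g) ->
    (forall S g, P S g -> P S g^-1%g) ->
    (forall (S : {fset X}) x, x \in S -> P S (iota x)) ->
  forall g, exists S, P S g.
Proof.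
move=> P1 PM PV Pi g.
suff [S HS] : exists S, forall S' : {fset X}, S `<=` S' -> P S' g.
  by exists S; apply: HS.
elim/free_ind: g => [|g h [S HS] [T HT]|g [S HS]|x].
- by exists fset0 => S' _; apply: P1.
- exists (S `|` T) => S'; rewrite fsubUset => /andP[SS' TS'].
  by apply: PM; [apply: HS|apply: HT].
- by exists S => S' /HS; apply: PV.
- by exists [fset x] => S'; rewrite fsub1set; apply: Pi.
Qed.

End FreeGroup.

(** * Second cohomology of a free group *)

Section CentralExtension.
Context (G : groupType) (R : comPzRingType) (z : cocycle2 G R).

(** The values of a cocycle lie in [R] seen as a module over itself; here they
    are read in the ring [R]. *)
Definition factor_set (g h : G) : R := val z (g, h).
Local Notation f := factor_set.

Lemma cocycleP g h k :
  f g (h * k)%g = f g h + f (g * h)%g k - f h k.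
Proof.
have /asboolP/(_ g h k) := valP z; rewrite /d2 -!/(f _ _) => /eqP.
rewrite subr_eq0 addrC => /eqP; rewrite -/(f g h) => <-; ring.
Qed.

Lemma cocycle1l g : f 1%g g = f 1%g 1%g.
Proof. by have := cocycleP 1%g 1%g g; rewrite !mul1g addrK. Qed.

Lemma cocycle1r g : f g 1%g = f 1%g 1%g.
Proof.
have := cocycleP g 1%g 1%g; rewrite !mulg1 => /eqP.
by rewrite eq_sym subr_eq (inj_eq (addrI _)) => /eqP.
Qed.

Lemma cocycleV g : f g^-1%g g = f g g^-1%g.
Proof.
have := cocycleP g g^-1%g g; rewrite mulgV mulVg cocycle1l cocycle1r => /eqP.
rewrite -subr_eq0 => /eqP e; apply/eqP; rewrite -subr_eq0 -e; apply/eqP; ring.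
Qed.

(** The extension of [G] by [R] with cocycle [- z]: the sign is chosen so that
    the first component of a multiplicative section has coboundary [z].  As [z]
    is not normalised, the unit is not [(0, 1)]. *)
Definition extension of cocycle2 G R := (R * G)%type.

Local Notation E := (extension z).
HB.instance Definition _ := Choice.on E.

Definition ext_one : E := (f 1%g 1%g, 1%g).
Definition ext_mul (a b : E) : E :=
  (a.1 + b.1 - f a.2 b.2, (a.2 * b.2)%g).
Definition ext_inv (a : E) : E :=
  (f 1%g 1%g + f a.2 a.2^-1%g - a.1, a.2^-1%g).

Lemma ext_mulA : associative ext_mul.
Proof.
move=> a b c; congr (_, _) => /=; last by rewrite mulgA.
rewrite cocycleP; ring.
Qed.
Lemma ext_mul1 : left_id ext_one ext_mul.
Proof.
by case=> r g; rewrite /ext_mul /= mul1g cocycle1l addrAC subrr add0r.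
Qed.
Lemma ext_1mul : right_id ext_one ext_mul.
Proof. by case=> r g; rewrite /ext_mul /= mulg1 cocycle1r addrK. Qed.
Lemma ext_mulV : left_inverse ext_one ext_inv ext_mul.
Proof.
case=> r g; rewrite /ext_mul /= mulVg cocycleV; congr (_, _) => /=; ring.
Qed.
Lemma ext_Vmul : right_inverse ext_one ext_inv ext_mul.
Proof.
case=> r g; rewrite /ext_mul /= mulgV; congr (_, _) => /=; ring.
Qed.

HB.instance Definition _ :=
  isGroup.Build E ext_mulA ext_mul1 ext_1mul ext_mulV ext_Vmul.

End CentralExtension.

(** Lifting the basis to the central extension defined by [z] gives a
    homomorphic section, whose [R]-component is the required cochain. *)
Lemma free_cocycle_coboundary (X : choiceType) (F : groupType) (iota : X -> F)
    (R : comPzRingType) (z : cocycle2 F R) :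
  free_basis iota -> exists c : cochain1 F R, d1 c = val z.
Proof.
move=> Ffree.
have [phi [phi_iota _]] := Ffree _ (fun x => (0, iota x) : extension z).
pose f g := (phi g).2.
have fM : monoid.monoid_morphism f.
  by split=> [|h k]; rewrite /f ?gmulf1 ?gmulfM.
pose f' : UMagmaMorphism.type F F := HB.pack f (isUMagmaMorphism.Build _ _ f fM).
have f_id g : (phi g).2 = g.
  by apply: (free_endo_id Ffree (f := f')) => x; rewrite /= /f phi_iota.
exists (fun g => (phi g).1); apply/funext => -[g h]; rewrite /d1 /= gmulfM /= !f_id.
change ((phi h).1 - ((phi g).1 + (phi h).1 - factor_set z g h) + (phi g).1 =
  factor_set z g h).
ring.
Qed.

(** * Transgression *)

Section Transgression.
Context (G : groupType) (N : normalClosed G) (R : comPzRingType).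
Local Notation Q := (quotient_group N).

Lemma pi_eq1 a : a \in N -> \pi_Q a = 1%g.
Proof. by move=> aN; rewrite -pi1; apply/esym/eq_cosetP; rewrite invg1 mul1g. Qed.

Lemma invariant_hom_eq (phi psi : invariant_hom N R) : phi =1 psi -> phi = psi.
Proof.
case: phi psi => [f fM fJ] [g gM gJ] /= /funext fg; case: _ / fg in gM gJ *.
by congr InvariantHom; apply: Prop_irrelevance.
Qed.

Lemma invariant_hom1 (phi : invariant_hom N R) : phi 1%g = 0.
Proof.
by apply: (addrI (phi 1%g)); rewrite addr0 -invariant_homM mulg1.
Qed.

(** The cochain [c] is additive as soon as one argument lies in [N], since [z] is
    then evaluated at a pair containing 1 and [c 1 = 0] makes [z] normalised.
    Both the homomorphism property on [N] and the invariance under conjugation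
    follow, the latter by computing [c] of [a * g = g * a ^ g] in two ways. *)
Lemma trg_of_cochain (c : cochain1 G R) (z : cocycle2 Q R) :
    c 1%g = 0 -> (forall g h, d1 c (g, h) = val z (\pi g, \pi h)) ->
  exists phi : invariant_hom N R,
    (forall a, phi a = c (val a)) /\ trg phi = class2 z.
Proof.
move=> c1 cz.
have z11 : factor_set z 1%g 1%g = 0.
  by rewrite /factor_set -[1%g]pi1 -cz /d1 /= mulg1 c1 subrr addr0.
have cM g h : c (g * h)%g = c g + c h - factor_set z (\pi g) (\pi h).
  by rewrite /factor_set -cz /d1 /=; ring.
have cMl a h : a \in N -> c (a * h)%g = c a + c h.
  by move=> /pi_eq1 aN; rewrite cM aN cocycle1l z11 subr0.
have cMr g a : a \in N -> c (g * a)%g = c g + c a.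
  by move=> /pi_eq1 aN; rewrite cM aN cocycle1r z11 subr0.
have homM (a b : subgroup N) : c (val (a * b)%g) = c (val a) + c (val b).
  by rewrite gmulfM cMl //; apply: valP.
have homJ g (a b : subgroup N) : val b = (val a ^ g)%g -> c (val b) = c (val a).
  move=> ba; apply: (addrI (c g)); rewrite -cMr; last exact: valP.
  by rewrite ba /conjg mulVKg cMl 1?addrC //; apply: valP.
exists (InvariantHom homM homJ); split=> //.
by apply: trg_unique; exists c, z.
Qed.

End Transgression.

Section Additivity.
Context (G : groupType) (N : normalClosed G) (R : comPzRingType).

Lemma invariant_hom_addM (phi psi : invariant_hom N R) a b :
  phi (a * b)%g + psi (a * b)%g = (phi a + psi a) + (phi b + psi b).
Proof. by rewrite !invariant_homM addrACA. Qed.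

Lemma invariant_hom_addJ (phi psi : invariant_hom N R) (g : G) a b :
  val b = (val a ^ g)%g -> phi b + psi b = phi a + psi a.
Proof. by move=> ba; rewrite !(invariant_homJ _ ba). Qed.

Definition invariant_hom_add (phi psi : invariant_hom N R) : invariant_hom N R :=
  InvariantHom (invariant_hom_addM phi psi) (invariant_hom_addJ phi psi).

Lemma trgD phi psi : trg (invariant_hom_add phi psi) = trg phi + trg psi.
Proof.
apply: trg_unique; have [c [z [cphi cz ->]]] := trgP phi.
have [c' [z' [cpsi cz' ->]]] := trgP psi.
exists (fun g => c g + c' g), (z + z'); split=> [a|g h|].
- by rewrite cphi cpsi.
- have -> : val (z + z') (\pi g, \pi h) =
    (val z (\pi g, \pi h) : R) + val z' (\pi g, \pi h) by [].
  by rewrite -cz -cz' /d1 /=; ring.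
- by rewrite class2D.
Qed.

(** Such a [phi] satisfies [phi + phi = phi], so its transgression is 0 by
    additivity. *)
Lemma trg0 (phi : invariant_hom N R) : (forall a, phi a = 0) -> trg phi = 0.
Proof.
move=> phi0; apply: (addrI (trg phi)); rewrite addr0 -trgD; congr trg.
by apply: invariant_hom_eq => a; rewrite /= !phi0 addr0.
Qed.

End Additivity.

(** * Transgression over a free group *)

Section TransgressionFree.
Context (X : choiceType) (F : groupType) (iota : X -> F).
Context (Ffree : free_basis iota) (R : comPzRingType).
Local Notation mu := (magnus_coef Ffree R).

Lemma magnus_coef1 w : mu w 1%g = (nilp w)%:R.
Proof. by rewrite /magnus_coef magnus1 Defs.coef1. Qed.

Lemma magnus_coef_letter x y : mu [:: x] (iota y) = (x == y)%:R.
Proof.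
rewrite /magnus_coef magnus_basis Defs.coefD Defs.coef1 add0r /coef /= /letter_fun.
by rewrite eqseq_cons andbT.
Qed.

Lemma magnus_coef_singleM x g h :
  mu [:: x] (g * h)%g = mu [:: x] g + mu [:: x] h.
Proof.
rewrite magnus_coefM /= big_ord_recl big_ord1 /= !magnus_coef_nil mulr1 mul1r.
by rewrite addrC.
Qed.

(** On the words in a finite set [S] of letters, [chi] is the homomorphism
    [e S], the sum over [S] of [chi (iota x)] times the coefficient at [x]. *)
Lemma free_hom_magnus (chi : F -> R) (g : F) :
    (forall h k, chi (h * k)%g = chi h + chi k) ->
    (forall x, mu [:: x] g = 0) ->
  chi g = 0.
Proof.
move=> chiM g0.
have chi1 : chi 1%g = 0.
  by apply: (addrI (chi 1%g)); rewrite addr0 -chiM mulg1.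
pose e (S : {fset X}) h := \sum_(x <- S) mu [:: x] h * chi (iota x).
have eM S h k : e S (h * k)%g = e S h + e S k.
  rewrite /e -big_split; apply: eq_bigr => x _.
  by rewrite magnus_coef_singleM mulrDl.
have e1 S : e S 1%g = 0.
  by rewrite /e big1 // => x _; rewrite magnus_coef1 mul0r.
have [S ->] : exists S, chi g = e S g; last first.
  by rewrite /e big1 // => x _; rewrite g0 mul0r.
apply: (free_ind_finite Ffree (P := fun S h => chi h = e S h)) => {g g0}.
- by move=> S; rewrite chi1 e1.
- by move=> S h k hE kE; rewrite chiM eM hE kE.
- move=> S h hE; apply: (addrI (chi h)).
  by rewrite -chiM hE -eM mulgV chi1 e1.
- move=> S x xS; rewrite /e (bigD1_seq x) ?fset_uniq //= magnus_coef_letter.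
  rewrite eqxx mul1r big1 ?addr0 // => y /negPf yx.
  by rewrite magnus_coef_letter yx mul0r.
Qed.

Context (n : nat).
Local Notation Fn := (magnus_filtration Ffree R n).

Lemma magnus_filtration_coef w m g : g \in magnus_filtration Ffree R m ->
  (0 < size w < m)%N -> mu w g = 0.
Proof.
move=> /asboolP/aug_ideal_pow_coef gm /andP[w0 wm]; rewrite -(gm _ wm).
by rewrite Defs.coefD; case: w w0 {wm} => // x w _; rewrite /coef /= subr0.
Qed.

(** The primitives of the two inflated cocycles differ, up to the inflation of
    a cochain of the quotient, by a homomorphism [F -> R]. *)
Lemma trg_free_inj : (2 <= n)%N -> injective (@trg F Fn R).
Proof.
move=> n_ge2 phi psi; have [c [z [cphi cz ->]]] := trgP phi.
have [c' [z' [cpsi cz' ->]]] := trgP psi.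
move=> /class2P[e zz'].
pose chi g := c g - c' g - e (\pi g).
have chiM h k : chi (h * k)%g = chi h + chi k.
  have := congr1 (fun f => f (\pi h, \pi k) : R) zz'.
  rewrite -[X in X = _]/((val z (\pi h, \pi k) : R) - val z' (\pi h, \pi k)).
  rewrite -cz -cz' /d1 /= -piM /chi => E.
  apply/esym/eqP; rewrite -subr_eq0; move/eqP: E; rewrite -subr_eq0 => /eqP <-.
  apply/eqP; ring.
have chiN (a : subgroup Fn) : phi a = psi a + e 1%g.
  have : chi (val a) = 0.
    apply: free_hom_magnus chiM _ => x; apply: magnus_filtration_coef (valP a) _.
    by rewrite n_ge2.
  rewrite /chi cphi cpsi pi_eq1; last exact: valP.
  by move/eqP; rewrite subr_eq0 subr_eq addrC => /eqP.
have e1 : e 1%g = 0 by have := chiN 1%g; rewrite !invariant_hom1 add0r.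
by apply: invariant_hom_eq => a; rewrite chiN e1 addr0.
Qed.

(** A primitive on [F] of the inflated cocycle exists; the constant [c 1] is
    subtracted from it, and the coboundary of that constant from [z], in order
    to meet the hypothesis of [trg_of_cochain] within the same class. *)
Lemma trg_free_surj alpha : exists phi, @trg F Fn R phi = alpha.
Proof.
elim/class2W: alpha => z.
pose z' : cochain2 F R := fun p => val z (\pi p.1, \pi p.2).
have zc : z' \in @is_cocycle2 F R.
  apply/asboolP => g h k; have /asboolP := valP z.
  by move=> /(_ (\pi g) (\pi h) (\pi k)); rewrite /d2 /z' /= !piM.
have [c cz] := free_cocycle_coboundary (Sub z' zc) Ffree.
pose k : cochain1 (quotient_group Fn) R := fun=> c 1%g.
have kc : d1 k \in @is_cocycle2 _ R by apply/asboolP => g h i; apply: d2_d1.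
have [||phi [_ trg_phi]] := @trg_of_cochain _ Fn R (fun g => c g - c 1%g)
    (z - Sub (d1 k) kc).
- by rewrite subrr.
- move=> g h; have := congr1 (fun f => f (g, h) : R) cz.
  rewrite /d1 /= => E.
  change (c h - c 1%g - (c (g * h)%g - c 1%g) + (c g - c 1%g) =
    (z' (g, h) : R) - (c 1%g - c 1%g + c 1%g)).
  rewrite -[z' _]E; ring.
exists phi; rewrite trg_phi; apply/class2P; exists (fun=> - c 1%g).
apply/funext => -[p q].
change ((val z (p, q) : R) - (c 1%g - c 1%g + c 1%g) - (val z (p, q) : R) =
  - c 1%g - - c 1%g - c 1%g); ring.
Qed.

End TransgressionFree.

(** * Massey values as transgressions of Magnus coefficients *)

Section MasseyValues.
Context (X : choiceType) (F : groupType) (iota : X -> F).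
Context (Ffree : free_basis iota) (R : comPzRingType) (n : nat) (n_gt0 : (0 < n)%N).
Local Notation mu := (magnus_coef Ffree R).
Local Notation FN := (quotient_group (magnus_filtration Ffree R n)).

(** The Massey cochain collects, up to the sign [(-1) ^+ n], the terms of the
    product formula for the coefficient at [w] in which both factors of [w] are
    nonempty; these are the terms by which that coefficient fails to be
    additive. *)
Lemma massey_primitive (w : n.-tuple X) g h :
  d1 (fun k => (-1) ^+ n.+1 * mu w k) (g, h) =
    massey_cochain n.+1 (cbar (Ffree:=Ffree) (R:=R) w) (\pi g, \pi h).
Proof.
have -> : massey_cochain n.+1 (cbar (Ffree:=Ffree) (R:=R) w) (\pi g, \pi h) =
    \sum_(1 <= a < n) (-1) ^+ n * (mu (take a w) g * mu (drop a w) h).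
  rewrite /massey_cochain functions.fct_sumE -[2%N]addn1 big_addn subn1.
  apply: eq_big_nat => a /andP[a1 an].
  rewrite /cup /= cbarE ?cbarE; try (by case; lia) || lia.
  have -> : subword w 1 (a + 1) = take a w by rewrite /subword addnK drop0.
  have -> : subword w (a + 1) n.+1 = drop a w.
    by rewrite /subword addn1 take_oversize // size_drop size_tuple; lia.
  by rewrite mulrACA -exprD; congr (_ ^+ _ * _); lia.
rewrite -big_distrr /= /d1 /= magnus_coefM size_tuple.
rewrite -(big_mkord xpredT (fun a => mu (take a w) g * mu (drop a w) h)).
rewrite big_nat_recr // big_ltn //= take0 drop0.
rewrite take_oversize ?drop_oversize ?size_tuple // !magnus_coef_nil exprS.
ring.
Qed.

Lemma massey_combination_primitive (s : seq (n.-tuple X)) (r : n.-tuple X -> R) :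
  exists z : cocycle2 FN R,
    class2 z = \sum_(w <- s) r w *: psi Ffree R w /\
    forall g h, d1 (fun k => \sum_(w <- s) r w * ((-1) ^+ n.+1 * mu w k)) (g, h) =
      val z (\pi g, \pi h).
Proof.
elim: s => [|w s [z [zE dz]]].
  exists 0; split=> [|g h]; rewrite ?big_nil; first by rewrite /class2 piE.
  by rewrite /d1 !big_nil subrr addr0.
exists (r w *: massey_cocycle2 (cbar_defining_system Ffree R w) + z); split=> [|g h].
  by rewrite class2D zE -scale2E big_cons.
have -> : val (r w *: massey_cocycle2 (cbar_defining_system Ffree R w) + z)
    (\pi g, \pi h) =
    r w * massey_cochain n.+1 (cbar (Ffree:=Ffree) (R:=R) w) (\pi g, \pi h) +
    val z (\pi g, \pi h) by [].
rewrite -massey_primitive -dz /d1 /= !big_cons.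
by ring.
Qed.

(** The primitive of [massey_combination_primitive] vanishes at 1 because the words
    have positive length, so it restricts to an invariant homomorphism with the
    same transgression as [phi]. *)
Lemma trg_massey (phi : invariant_hom (magnus_filtration Ffree R n) R)
    (s : seq (n.-tuple X)) (r : n.-tuple X -> R) a :
    injective (@trg F (magnus_filtration Ffree R n) R) ->
    trg phi = \sum_(w <- s) r w *: psi Ffree R w ->
  phi a = (-1) ^+ n.+1 * \sum_(w <- s) r w * mu w (val a).
Proof.
move=> inj_trg phiE.
have [z [zE dz]] := massey_combination_primitive s r.
have [|phi' [phi'E trg_phi']] := trg_of_cochain _ dz.
  apply: big1 => w _; rewrite magnus_coef1 /nilp size_tuple.
  by rewrite -[n == 0%N]negbK -lt0n n_gt0 !mulr0.
rewrite (inj_trg phi phi'); last by rewrite phiE trg_phi' zE.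
by rewrite phi'E mulr_sumr; apply: eq_bigr => w _; rewrite mulrCA.
Qed.

Lemma psi_in_H2_Massey w0 : H2_Massey Ffree R n (psi Ffree R w0).
Proof.
exists [fsfun w in [fset w0] => 1 | 0]; first by [].
rewrite /massey_map.
rewrite (big_fset_incl _ (finsupp_sub _ _ _)) => [|w _ wr]; last first.
  by rewrite memNfinsupp in wr; rewrite (eqP wr) scale0r.
by rewrite big_seq_fset1 fsfunE inE eqxx scale1r.
Qed.

End MasseyValues.

(** * Series in finitely many letters and powers of the augmentation ideal *)

Section FiniteSupport.
Context (X : choiceType) (R : comPzRingType).

Definition letters_in (S : {fset X}) (f : series X R) : Prop :=
  forall w, ~~ all [in S] w -> coef w f = 0.

Lemma letters_inM S f g : letters_in S f -> letters_in S g -> letters_in S (f * g).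
Proof.
move=> fS gS w wS; rewrite Defs.coefM big1 // => i _.
have : ~~ all [in S] (take i w ++ drop i w) by rewrite cat_take_drop.
by rewrite all_cat negb_and => /orP[/fS->|/gS->]; rewrite ?mul0r ?mulr0.
Qed.

(** The coefficient of an inverse at [w] is a combination of coefficients of the
    inverse at proper suffixes [v] of [w = u ++ v], with weights [coef u f]; if
    [w] uses a letter outside [S], then so does [u] or [v]. *)
Lemma letters_inV S f g :
  letters_in S f -> coef [::] f = 1 -> f * g = 1 -> letters_in S g.
Proof.
move=> fS f1 fg w; have [m] := ubnP (size w); elim: m w => // m IH w wm wS.
have := congr1 (coef w) fg; rewrite Defs.coef1 Defs.coefM big_ord_recl /=.
rewrite take0 drop0 f1 mul1r big1 ?addr0; first by case: w wS {wm}.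
move=> i _; have : ~~ all [in S] (take (bump 0 i) w ++ drop (bump 0 i) w).
  by rewrite cat_take_drop.
rewrite all_cat negb_and => /orP[/fS->|]; first by rewrite mul0r.
move=> /IH ->; rewrite ?mulr0 // size_drop.
by rewrite /bump; have := ltn_ord i; lia.
Qed.

Lemma shift_is_series x (f : series X R) : shift x (val f) \in @is_series X R.
Proof.
apply/asboolP => k; have /asboolP/(_ k.+1) := valP f.
move=> /(finite_image behead); apply: sub_finite_set => w [wk fw].
by exists (x :: w) => //; split=> //=; rewrite wk.
Qed.

Definition series_shift x (f : series X R) : series X R :=
  Sub (shift x (val f)) (shift_is_series x f).

Lemma coef_letterM (x : X) (f : series X R) w :
  coef w (letter R x * f) =
    if w is y :: u then if y == x then coef u f else 0 else 0.
Proof.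
case: w => [|y u]; rewrite Defs.coefM.
  by rewrite big_ord1 /= /coef /= /letter_fun /= mul0r.
rewrite big_ord_recl big_ord_recl big1 => [|i _].
  rewrite /= take0 drop0 /coef /= /letter_fun /= eqseq_cons andbT mul0r.
  by case: (y == x); rewrite ?mul1r ?mul0r ?add0r ?addr0.
rewrite {1}/coef /= /letter_fun /bump /= eqseq_cons.
by case: u i => [[]|v u i] //=; rewrite andbF mul0r.
Qed.

Lemma series_letters_sum (S : {fset X}) f :
    letters_in S f -> coef [::] f = 0 ->
  f = \sum_(x <- S) letter R x * series_shift x f.
Proof.
move=> fS f0; apply: seriesP => w.
have coef_sum (s : seq X) (h : X -> series X R) :
    coef w (\sum_(x <- s) h x) = \sum_(x <- s) coef w (h x).
  by elim: s => [|x s IH]; rewrite ?big_nil // !big_cons Defs.coefD IH.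
rewrite coef_sum; case: w => [|y u] in coef_sum *.
  by rewrite f0 big1 // => x _; rewrite coef_letterM.
have [yS|yS] := boolP (y \in S).
  rewrite (bigD1_seq y) ?fset_uniq //= coef_letterM eqxx big1 ?addr0 // => x.
  by rewrite coef_letterM eq_sym => /negPf ->.
rewrite fS /= ?(negPf yS) // big_seq big1 // => x xS; rewrite coef_letterM.
by case: eqP yS => // ->; rewrite xS.
Qed.

(** Splitting off the first letter reduces [m.+1] to [m]; the left factor [t]
    accumulates the letters already split off, so that the ideal stays fixed
    during the induction. *)
Lemma ideal_of_words (I : set (series X R)) (S : {fset X}) m f t :
    two_sided_ideal I ->
    (forall u, size u = m -> I (t * \prod_(x <- u) letter R x)) ->
    letters_in S f -> (forall w, (size w < m)%N -> coef w f = 0) ->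
  I (t * f).
Proof.
move=> I_ideal; have [I0 ID IM] := I_ideal; elim: m f t => [|m IH] f t tI fS f0.
  by have := IM 1 _ f (tI [::] erefl); rewrite big_nil mul1r mulr1.
rewrite (series_letters_sum fS) ?f0 // mulr_sumr.
apply: (big_ind I) => // x _; rewrite mulrA; apply: IH => [u um|w wS|w wm].
- by have := tI (x :: u); rewrite big_cons mulrA /= um; apply.
- by apply: (fS (x :: w)); rewrite /= negb_and wS orbT.
- exact: (f0 (x :: w)).
Qed.

Lemma aug_ideal_pow_finite (S : {fset X}) m (f : series X R) :
    letters_in S f -> (forall w, (size w < m)%N -> coef w f = 0) ->
  ideal_pow (@aug_ideal X R) m f.
Proof.
move=> fS f0; rewrite -[f]mul1r.
apply: (ideal_of_words (S := S) (m := m)) => // [|u um].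
  exact: ideal_gen_ideal.
pose v : m.-tuple X := Tuple (introT eqP um).
rewrite mul1r => I _; apply; exists (fun i => letter R (tnth v i)).
  by move=> i J _; apply; exists (tnth v i).
by rewrite -(big_tuple _ _ v xpredT (letter R)).
Qed.

End FiniteSupport.

(** * The Magnus filtration through coefficients *)

Section MagnusFinite.
Context (X : choiceType) (F : groupType) (iota : X -> F).
Context (Ffree : free_basis iota) (R : comPzRingType).

Lemma coef_sub1 (f : series X R) w : coef w (f - 1) = coef w f - (nilp w)%:R.
Proof. by []. Qed.

Lemma magnus_letters_in g : exists S, letters_in S (val (magnus Ffree R g)).
Proof.
pose P S h := letters_in S (val (magnus Ffree R h)).
apply: (free_ind_finite Ffree (P := P)) => {g}; rewrite /P.
- by move=> S [|x w] // _; rewrite magnus1 Defs.coef1.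
- by move=> S h k hS kS; rewrite magnusM; apply: letters_inM.
- move=> S h hS; apply: letters_inV hS _ _; first exact: magnus_coef_nil.
  by rewrite -magnusM mulgV magnus1.
- move=> S x xS w; rewrite magnus_basis Defs.coefD Defs.coef1 /coef /= /letter_fun.
  case: w => [|y w] //=; rewrite add0r eqseq_cons.
  by case: eqP => //= ->; rewrite xS; case: w.
Qed.

(** The filtration is defined by powers of the ideal generated by the letters,
    but on the image of the Magnus map these can be read off the coefficients,
    by [magnus_letters_in]. *)
Lemma magnus_filtrationP m g :
  g \in magnus_filtration Ffree R m <->
  forall w, (0 < size w < m)%N -> magnus_coef Ffree R w g = 0.
Proof.
split=> [gm w|g0]; first exact: magnus_filtration_coef.
have [S gS] := magnus_letters_in g; apply/asboolP.
apply: (aug_ideal_pow_finite (S := S)).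
  move=> w wS; rewrite coef_sub1 gS // sub0r.
  by case: w wS => // x w _; rewrite oppr0.
move=> w wm; rewrite coef_sub1; case: w wm => [|x w] wm.
  by rewrite [X in X - _]magnus_coef_nil subrr.
by rewrite [X in X - _]g0 // subrr.
Qed.

End MagnusFinite.

(** * The pairing *)

Theorem theorem9p2 (X : choiceType) (F : groupType) (iota : X -> F)
    (Ffree : free_basis iota) (R : comPzRingType) (n : nat) (n_ge2 : (2 <= n)%N) :
  let Fn : normalClosed F := magnus_filtration Ffree R n in
  let Fn1 : normalClosed F := magnus_filtration Ffree R n.+1 in
  let gr := quotient_group (restrict Fn Fn1) in
  let M := H2_Massey Ffree R n in
  exists trg_inv : H2 (quotient_group Fn) R -> invariant_hom Fn R,
    [/\ cancel (@trg F Fn R) trg_inv, cancel trg_inv (@trg F Fn R)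
      & exists pairing : gr -> H2 (quotient_group Fn) R -> R,
        [/\ (forall (g : subgroup Fn) alpha, M alpha ->
               pairing (\pi_gr g) alpha = trg_inv alpha g),
            (forall a b alpha, M alpha ->
               pairing (a * b)%g alpha = pairing a alpha + pairing b alpha),
            (forall a alpha beta, M alpha -> M beta ->
               pairing a (alpha + beta) = pairing a alpha + pairing a beta),
            (forall a, (forall alpha, M alpha -> pairing a alpha = 0) -> a = 1%g)
          & (forall alpha, M alpha -> (forall a, pairing a alpha = 0) -> alpha = 0)]].
Proof.
move=> Fn Fn1 gr M.
have n_gt0 : (0 < n)%N by apply: leq_trans n_ge2.
have trg_inj : injective (@trg F Fn R) := trg_free_inj n_ge2.
pose trg_inv (alpha : H2 (quotient_group Fn) R) :=
  projT1 (cid (trg_free_surj alpha)).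
have trg_invK : cancel trg_inv (@trg F Fn R).
  by move=> alpha; rewrite /trg_inv; case: (cid _).
have trgK : cancel (@trg F Fn R) trg_inv by move=> phi; apply: trg_inj.
exists trg_inv; split=> //.
pose pairing (a : gr) alpha := trg_inv alpha (repr a).
have invE alpha r : massey_map Ffree R n r = alpha -> forall g : subgroup Fn,
    trg_inv alpha g =
      (-1) ^+ n.+1 * \sum_(w <- finsupp r) r w * magnus_coef Ffree R w (val g).
  by move=> rE g; apply: (trg_massey n_gt0 _ trg_inj); rewrite trg_invK -rE.
have inv0 alpha (g : subgroup Fn) : M alpha -> val g \in Fn1 -> trg_inv alpha g = 0.
  move=> [r _ rE] /magnus_filtrationP g0; rewrite (invE _ _ rE).
  by rewrite big1 ?mulr0 // => w _; rewrite g0 ?mulr0 // size_tuple n_gt0 ltnSn.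
have pairingE (g : subgroup Fn) alpha :
    M alpha -> pairing (\pi_gr g) alpha = trg_inv alpha g.
  move=> alphaM; apply: (addrI (trg_inv alpha g^-1%g)).
  rewrite -!invariant_homM mulVg invariant_hom1 inv0 //.
  exact: (repr_coset (restrict Fn Fn1) g).
have trg_invD alpha beta g :
    trg_inv (alpha + beta) g = trg_inv alpha g + trg_inv beta g.
  by rewrite -{1}[alpha]trg_invK -{1}[beta]trg_invK -trgD trgK.
exists pairing; split=> //.
- move=> a b alpha alphaM; rewrite -[a]reprK -[b]reprK -piM !pairingE //.
  exact: invariant_homM.
- by move=> a alpha beta _ _; apply: trg_invD.
(* Left kernel: coefficients of length < n vanish because [repr a] lies in [Fn],
   those of length n because, up to sign, they are the values of the
   pairing at the [psi]. *)
- move=> a a0; rewrite -[a]reprK -pi1; apply/esym/eq_cosetP.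
  rewrite invg1 mul1g; apply/magnus_filtrationP => w /andP[w0].
  rewrite ltnS leq_eqVlt => /orP[/eqP wn|wn]; last first.
    by apply: magnus_filtration_coef (valP (repr a)) _; rewrite w0.
  pose u : n.-tuple X := Tuple (introT eqP wn).
  have := a0 _ (psi_in_H2_Massey Ffree R u).
  rewrite /pairing (trg_massey n_gt0 (s := [:: u]) (r := fun=> 1) _ trg_inj).
    rewrite big_seq1 mul1r => /(congr1 ( *%R ((-1) ^+ n.+1))).
    by rewrite signrMK mulr0.
  by rewrite trg_invK big_seq1 scale1r.
(* Right kernel: the homomorphism [trg_inv alpha] itself is zero. *)
- move=> alpha alphaM alpha0; rewrite -[alpha]trg_invK; apply: trg0 => g.
  by rewrite -pairingE // alpha0.
Qed.
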